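(* The randomized marking algorithm for classical unweighted paging is $O(\log k)$-competitive: there is an absolute constant $C$ such that for every cache size $k\ge 1$ and every finite page universe there is a constant $b$, independent of the number of page requests, such that for every request sequence $\sigma$, $$\mathbb E[\mathrm{cost}_{RM}(\sigma)]\le C\ln(1+k)\cdot \mathrm{cost}_{OPT}(\sigma)+b,$$ where $RM$ is the randomized marking algorithm and $\mathrm{cost}_{OPT}(\sigma)$ is the minimum cost of an offline algorithm on $\sigma$.
   Context: Unweighted paging: a cache holds $k$ pages; pages $p_1,p_2,\dots$ are requested one by one; if the requested page is not in the cache, the algorithm pays 1 and must bring it into the cache by evicting another page. An offline algorithm knows the whole request sequence in advance. Randomized marking ($RM$): initially all pages in the cache are unmarked. When $p_t$ is requested: if $p_t$ is in the cache, it is marked and nothing else changes. If $p_t$ is not in the cache, a page chosen uniformly at random from the unmarked pages currently in the cache is evicted, and $p_t$ is brought into the cache and marked. If such an eviction is needed but there are no unmarked pages left in the cache, the current phase ends: all pages in the cache become unmarked, a new phase begins, and the request is processed in the new phase. *)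

(* Defs.v *)
From HB Require Import structures.
From mathcomp Require Import all_boot all_order all_algebra.
From mathcomp Require Import reals exp.

Set Implicit Arguments.
Unset Strict Implicit.
Unset Printing Implicit Defensive.

Import Order.TTheory GRing.Theory Num.Theory.

Local Open Scope ring_scope.

(* A run on the requests p_1, ..., p_n from the cache C_0 is recorded as the
   list of caches C_1, ..., C_n, where C_t is the cache after p_t is served.
   Caches are sets of at most k pages: a fault forces an eviction only when the
   cache is full. From a cache of size k all later caches have size k, and every
   fault is then served by evicting exactly one page. *)

Fixpoint faults (T : finType) (C : {set T}) (sigma : seq T) (w : seq {set T})
    : nat :=
  match sigma, w with
  | p :: sigma', C' :: w' => ((p \notin C) + faults C' sigma' w')%N
  | _, _ => 0%N
  end.

Definition paging_step (T : finType) (k : nat) (p : T) (C C' : {set T}) : bool :=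
  if p \in C then C' == C
  else ((#|C| < k)%N && (C' == p |: C)) || [exists q in C, C' == p |: (C :\ q)].

Fixpoint offline_run (T : finType) (k : nat) (C : {set T}) (sigma : seq T)
    (w : seq {set T}) : bool :=
  match sigma, w with
  | [::], [::] => true
  | p :: sigma', C' :: w' => paging_step k p C C' && offline_run k C' sigma' w'
  | _, _ => false
  end.

(* The default value [size sigma] bounds the number of faults of every run, so
   it does not affect the minimum; see [opt_cost_attained] and [opt_cost_le]. *)
Definition opt_cost (T : finType) (k : nat) (C0 : {set T}) (sigma : seq T) : nat :=
  \big[minn/size sigma]_(w : (size sigma).-tuple {set T} | offline_run k C0 sigma w)
    faults C0 sigma w.

(* A state (C, M) of randomized marking is a cache C with its set M of marked
   pages. *)
Definition rm_state (T : finType) : finType := ({set T} * {set T})%type.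

(* Probability of moving from s to s' when p is requested. On a fault with a
   full cache, M' is the set of marked pages after the possible phase change. *)
Definition rm_step (R : realType) (T : finType) (k : nat) (p : T)
    (s s' : rm_state T) : R :=
  let: (C, M) := s in
  if p \in C then (s' == (C, p |: M))%:R
  else if (#|C| < k)%N then (s' == (p |: C, p |: M))%:R
  else
    let M' := if C \subset M then set0 else M in
    let U := C :\: M' in
    \sum_(q in U) #|U|%:R^-1 * (s' == (p |: (C :\ q), p |: M'))%:R.

Fixpoint rm_run_prob (R : realType) (T : finType) (k : nat) (s : rm_state T)
    (sigma : seq T) (w : seq (rm_state T)) : R :=
  match sigma, w with
  | [::], [::] => 1
  | p :: sigma', s' :: w' => rm_step R k p s s' * rm_run_prob R k s' sigma' w'
  | _, _ => 0
  end.

Definition rm_expected_cost (R : realType) (T : finType) (k : nat)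
    (C0 : {set T}) (sigma : seq T) : R :=
  \sum_(w : (size sigma).-tuple (rm_state T))
    rm_run_prob R k (C0, set0) sigma w * (faults C0 sigma (map fst w))%:R.

Lemma faults_le_size (T : finType) (C : {set T}) (sigma : seq T)
    (w : seq {set T}) : (faults C sigma w <= size sigma)%N.
Proof.
elim: sigma w C => [|p sigma IH] [|C' w] C //=.
by rewrite -[leqRHS]add1n; apply: leq_add; rewrite ?leq_b1 ?IH.
Qed.

Lemma offline_run_exists (T : finType) (k : nat) (C0 : {set T}) (sigma : seq T) :
  (0 < k)%N -> exists w : (size sigma).-tuple {set T}, offline_run k C0 sigma w.
Proof.
move=> k0; elim: sigma C0 => [|p sigma IH] C; first by exists [tuple].
have [C' CC'] : exists C', paging_step k p C C'.
  rewrite /paging_step; case: (boolP (p \in C)) => _; first by exists C.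
  have [-> | [q qC]] := set_0Vmem C.
    by exists (p |: set0); rewrite cards0 k0 eqxx.
  exists (p |: (C :\ q)); apply/orP; right.
  by apply/existsP; exists q; rewrite qC eqxx.
have [w Hw] := IH C'.
by exists [tuple of C' :: w]; rewrite /= CC'.
Qed.

Lemma opt_cost_le (T : finType) (k : nat) (C0 : {set T}) (sigma : seq T)
    (w : (size sigma).-tuple {set T}) :
  offline_run k C0 sigma w -> (opt_cost k C0 sigma <= faults C0 sigma w)%N.
Proof.
move=> Hw; rewrite /opt_cost; have := mem_index_enum w.
elim: (index_enum _) => [//|v s IH]; rewrite inE big_cons.
case/orP => [/eqP <-|/IH le_s]; first by rewrite Hw geq_minl.
by case: ifP => // _; rewrite geq_min le_s orbT.
Qed.

Lemma opt_cost_attained (T : finType) (k : nat) (C0 : {set T}) (sigma : seq T) :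
  (0 < k)%N ->
  exists2 w : (size sigma).-tuple {set T},
    offline_run k C0 sigma w & faults C0 sigma w = opt_cost k C0 sigma.
Proof.
move=> k0; have [w0 Hw0] := offline_run_exists C0 sigma k0.
pose F (w : (size sigma).-tuple {set T}) := faults C0 sigma w.
pose P (w : (size sigma).-tuple {set T}) := offline_run k C0 sigma w.
have [] := @arg_minnP _ w0 P F Hw0.
move=> w Hw wmin; exists w => //; apply/eqP; rewrite eqn_leq opt_cost_le // andbT.
rewrite /opt_cost; elim/big_ind: _ => //; first exact: faults_le_size.
by move=> x y hx hy; rewrite leq_min hx hy.
Qed.

Lemma rm_step_ge0 (R : realType) (T : finType) (k : nat) (p : T)
    (s s' : rm_state T) : 0 <= rm_step R k p s s'.
Proof.
case: s => C M; rewrite /rm_step; do 2?case: ifP => _; rewrite ?ler0n //.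
all: by apply: sumr_ge0 => q _; rewrite mulr_ge0 ?invr_ge0 ?ler0n.
Qed.

Lemma rm_step_sum1 (R : realType) (T : finType) (k : nat) (p : T)
    (s : rm_state T) : (0 < k)%N -> \sum_s' rm_step R k p s s' = 1.
Proof.
move=> k0; case: s => C M.
have sum_dirac (a : rm_state T) : \sum_s' (s' == a)%:R = 1 :> R.
  by rewrite (bigD1 a) //= eqxx big1 ?addr0 // => i /negbTE ->.
rewrite /rm_step; case: (p \in C); first exact: sum_dirac.
case: (ltnP #|C| k) => [_|kC]; first exact: sum_dirac.
set M' := if _ then _ else _; rewrite exchange_big /=.
under eq_bigr do rewrite -mulr_sumr sum_dirac mulr1.
rewrite sumr_const -[_ *+ _]mulr_natr mulVf // pnatr_eq0 -lt0n card_gt0.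
rewrite setD_eq0 /M'; case: (boolP (C \subset M)) => // _.
by rewrite subset0 -card_gt0 (leq_trans k0).
Qed.

(* Main.v *)
(* Proof idea. As the requests are oblivious, during a phase the unmarked part
   of the cache is uniform among the subsets of given size of the set U of
   not yet requested pages of the cache at the start of the phase. Hence the
   expected cost obeys a deterministic recursion in U and the set M of marked
   pages. Call a request clean if its page lies outside M and U, or if it starts
   a phase. A clean request costs 1 and raises the number m of pages of U
   missing from the cache by at most 1; a request for a page of U costs m / |U|,
   which is the drop of m * H_|U| when |U| decreases by 1. So the expected cost
   is at most (1 + H_k) times the number of clean requests. That number is at
   most 2 OPT, since for the offline cache O the potential
   |M \ O| + |O \ (M u U)| drops by 1 at each clean request and grows by at most
   2 at each offline fault. *)
Require Import Defs.
From HB Require Import structures.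
From mathcomp Require Import all_boot all_order all_algebra.
From mathcomp Require Import reals exp.
From mathcomp Require Import zify ring lra.

Set Implicit Arguments.
Unset Strict Implicit.
Unset Printing Implicit Defensive.

Import Order.TTheory GRing.Theory Num.Theory.

Local Open Scope ring_scope.

(** * Expected cost as a recursion over the requests *)

Lemma big_cons_tuple (R : nmodType) (T : finType) (n : nat)
    (F : n.+1.-tuple T -> R) :
  \sum_w F w = \sum_x \sum_(w : n.-tuple T) F [tuple of x :: w].
Proof.
rewrite pair_big /=.
rewrite (reindex (fun u : T * n.-tuple T => [tuple of u.1 :: u.2])) //=.
exists (fun w => (thead w, [tuple of behead w])) => [[x w] _|w _] /=.
  by rewrite theadE; congr (_, _); apply: val_inj.
by rewrite -tuple_eta.
Qed.

Fixpoint rm_cost (R : realType) (T : finType) (k : nat) (s : rm_state T)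
    (sigma : seq T) : R :=
  if sigma is p :: sigma' then
    (p \notin s.1)%:R + \sum_s' rm_step R k p s s' * rm_cost R k s' sigma'
  else 0.

Lemma rm_run_prob_sum1 (R : realType) (T : finType) (k : nat) (s : rm_state T)
    (sigma : seq T) : (0 < k)%N ->
  \sum_(w : (size sigma).-tuple (rm_state T)) rm_run_prob R k s sigma w = 1.
Proof.
move=> k0; elim: sigma s => [|p sigma IH] s /=.
  rewrite (bigD1 [tuple]) //= big1 ?addr0 // => w /negP[].
  by apply/eqP; rewrite tuple0.
rewrite big_cons_tuple -[RHS](rm_step_sum1 R p s k0).
by apply: eq_bigr => s' _; rewrite /= -mulr_sumr IH mulr1.
Qed.

(** Condition on the first transition: the probabilities of all continuations sum to 1, so the first
    fault is counted exactly once. *)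
Lemma rm_expected_costE (R : realType) (T : finType) (k : nat) (s : rm_state T)
    (sigma : seq T) : (0 < k)%N ->
  \sum_(w : (size sigma).-tuple (rm_state T))
    rm_run_prob R k s sigma w * (faults s.1 sigma (map fst w))%:R
  = rm_cost R k s sigma.
Proof.
move=> k0; elim: sigma s => [|p sigma IH] s /=.
  by rewrite big1 // => w _; rewrite mulr0.
rewrite big_cons_tuple /=.
transitivity (\sum_s' rm_step R k p s s' *
    ((p \notin s.1)%:R + rm_cost R k s' sigma)); last first.
  under [LHS]eq_bigr do rewrite mulrDr.
  by rewrite big_split /= -mulr_suml rm_step_sum1 // mul1r.
apply: eq_bigr => s' _.
under [LHS]eq_bigr do rewrite /= natrD -mulrA mulrDr.
rewrite -mulr_sumr big_split /= -mulr_suml rm_run_prob_sum1 // mul1r.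
by rewrite (IH s').
Qed.

(** * Sums over subsets of fixed size *)

Lemma sum_subsets1 (R : pzSemiRingType) (T : finType) (U : {set T}) (j : nat) :
  \sum_(D : {set T} | (D \subset U) && (#|D| == j)) (1 : R) = 'C(#|U|, j)%:R.
Proof.
rewrite sumr_const -(cards_draws U j); congr (_ *+ _).
by apply: eq_card => D; rewrite inE.
Qed.

Lemma sum_subsets_full (R : nmodType) (T : finType) (U : {set T})
    (f : {set T} -> R) :
  \sum_(D : {set T} | (D \subset U) && (#|D| == #|U|)) f D = f U.
Proof.
rewrite (bigD1 U) /= ?subxx ?eqxx // big1 ?addr0 // => D.
by case/andP=> /andP[DU /eqP cD]; rewrite eqEcard DU cD leqnn.
Qed.

Lemma sum_subsets_remove (R : nmodType) (T : finType) (U : {set T}) (j : nat)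
    (q : T) (g : {set T} -> R) : q \in U ->
  \sum_(D : {set T} | (D \subset U) && (#|D| == j.+1) && (q \in D)) g (D :\ q)
  = \sum_(E : {set T} | (E \subset (U :\ q)) && (#|E| == j)) g E.
Proof.
move=> qU; rewrite (reindex_onto (fun E => q |: E) (fun D => D :\ q)) /=; last first.
  by move=> D /andP[_ qD]; rewrite setD1K.
apply: eq_big => E; last by case/andP=> _ /eqP ->.
rewrite setU11 andbT subsetD1 subUset sub1set qU /=.
case: (boolP (q \in E)) => qE /=.
  rewrite !andbF /=; apply/negbTE/negP => /andP[_ /eqP/setP/(_ q)].
  by rewrite !inE eqxx qE.
by rewrite setU1K // eqxx !andbT cardsU1 qE.
Qed.

(** Double counting: each [E] arises from the [#|U| - j] pages [q] of [U] outside [E]. Hence a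
    uniform eviction from a uniform subset leaves a uniform subset. *)
Lemma sum_subsets_evict (R : pzSemiRingType) (T : finType) (U : {set T}) (j : nat)
    (g : {set T} -> R) :
  \sum_(D : {set T} | (D \subset U) && (#|D| == j.+1)) \sum_(q in D) g (D :\ q)
  = (#|U| - j)%:R * \sum_(E : {set T} | (E \subset U) && (#|E| == j)) g E.
Proof.
transitivity (\sum_(q in U) \sum_(E : {set T} | (E \subset (U :\ q)) && (#|E| == j)) g E).
  rewrite (exchange_big_dep (mem U)) /=.
    by apply: eq_bigr => q qU; rewrite sum_subsets_remove.
  by move=> D q /andP[/subsetP DU _] /DU.
rewrite (exchange_big_dep (fun E : {set T} => (E \subset U) && (#|E| == j))) /=.
  rewrite mulr_sumr; apply: eq_bigr => E /andP[EU /eqP cE].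
  rewrite -cE -cardsDS // mulr_natl sumr_const; congr (_ *+ _).
  by apply: eq_card => q; rewrite unfold_in /= !inE subsetD1 EU eqxx andbT andbC.
by move=> q E _; rewrite subsetD1 => /andP[/andP[-> _] ->].
Qed.

(** * Reduction of randomized marking to a deterministic recursion *)

Lemma rm_cost_hit (R : realType) (T : finType) (k : nat) (p : T)
    (C M : {set T}) (sigma : seq T) : p \in C ->
  rm_cost R k (C, M) (p :: sigma) = rm_cost R k (C, p |: M) sigma.
Proof.
move=> pC; rewrite /= pC add0r (bigD1 (C, p |: M)) //= eqxx mul1r.
by rewrite big1 ?addr0 // => s /negbTE ->; rewrite mul0r.
Qed.

Lemma rm_cost_fill (R : realType) (T : finType) (k : nat) (p : T)
    (C M : {set T}) (sigma : seq T) : p \notin C -> (#|C| < k)%N ->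
  rm_cost R k (C, M) (p :: sigma) = 1 + rm_cost R k (p |: C, p |: M) sigma.
Proof.
move=> pC Ck; rewrite /= pC (negbTE pC) Ck; congr (_ + _).
rewrite (bigD1 (p |: C, p |: M)) //= eqxx mul1r.
by rewrite big1 ?addr0 // => s /negbTE ->; rewrite mul0r.
Qed.

Lemma rm_cost_evict (R : realType) (T : finType) (k : nat) (p : T)
    (C M : {set T}) (sigma : seq T) : p \notin C -> (k <= #|C|)%N ->
  let M' := if C \subset M then set0 else M in
  rm_cost R k (C, M) (p :: sigma) =
    1 + #|C :\: M'|%:R^-1 *
        \sum_(q in C :\: M') rm_cost R k (p |: (C :\ q), p |: M') sigma.
Proof.
move=> pC kC M'; rewrite /= pC (negbTE pC) ltnNge kC /= -/M'; congr (_ + _).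
under eq_bigr do rewrite mulr_suml.
rewrite exchange_big mulr_sumr; apply: eq_bigr => q _ /=.
rewrite (bigD1 (p |: (C :\ q), p |: M')) //= eqxx mulr1.
by rewrite big1 ?addr0 // => s /negbTE ->; rewrite mulr0 mul0r.
Qed.

(* Expected cost when M is the set of marked pages, U the set of unmarked pages
   of the cache at the start of the phase that have not been requested since,
   and the unmarked part of the cache is a uniformly distributed subset of U
   with k - |M| elements: a page of U is then missing from the cache with
   probability (|U| + |M| - k) / |U|. The truncated subtraction makes this
   probability 0 as long as the cache is not full. *)
Fixpoint mean_cost (R : realType) (T : finType) (k : nat) (U M : {set T})
    (sigma : seq T) : R :=
  if sigma is p :: sigma' then
    if p \in M then mean_cost R k U M sigma'
    else if #|M| == k then 1 + mean_cost R k M [set p] sigma'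
    else if p \in U then
      (#|U| + #|M| - k)%:R / #|U|%:R + mean_cost R k (U :\ p) (p |: M) sigma'
    else 1 + mean_cost R k U (p |: M) sigma'
  else 0.

Lemma rm_cost_evict_unmarked (R : realType) (T : finType) (p : T)
    (M D : {set T}) (sigma : seq T) :
  p \notin M -> p \notin D -> [disjoint M & D] -> (0 < #|D|)%N ->
  rm_cost R (#|M| + #|D|) (M :|: D, M) (p :: sigma) =
    1 + #|D|%:R^-1 *
        \sum_(q in D) rm_cost R (#|M| + #|D|) (p |: M :|: D :\ q, p |: M) sigma.
Proof.
move=> pM pD MD D0.
have cC : #|M :|: D| = (#|M| + #|D|)%N.
  by rewrite cardsU (eqP (_ : M :&: D == set0)) ?cards0 ?subn0 // setI_eq0.
rewrite rm_cost_evict ?inE ?negb_or ?pM ?cC //.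
have -> : (M :|: D \subset M) = false.
  apply/negbTE/negP => /subset_leq_card; rewrite cC; lia.
have -> : (M :|: D) :\: M = D.
  by rewrite setDUl setDv set0U; apply/setDidPl; rewrite disjoint_sym.
congr (1 + _ * _); apply: eq_bigr => q qD; congr rm_cost.
have qM : q \notin M by apply: contraL qD => qM; rewrite (disjointFr MD).
congr (_, _); rewrite -setUA setDUl; congr (_ |: (_ :|: _)).
by apply/setDidPl; rewrite disjoint_sym disjoints1.
Qed.

Lemma rm_cost_new_phase (R : realType) (T : finType) (p : T) (M : {set T})
    (sigma : seq T) : p \notin M -> (0 < #|M|)%N ->
  rm_cost R #|M| (M, M) (p :: sigma) =
    1 + #|M|%:R^-1 *
        \sum_(E : {set T} | (E \subset M) && (#|E| == #|M|.-1))
          rm_cost R #|M| ([set p] :|: E, [set p]) sigma.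
Proof.
move=> pM M0; rewrite rm_cost_evict // subxx setD0 setU0.
have := @sum_subsets_evict R T M #|M|.-1
  (fun E => rm_cost R #|M| ([set p] :|: E, [set p]) sigma).
rewrite (prednK M0) sum_subsets_full => ->.
have -> : (#|M| - #|M|.-1 = 1)%N by lia.
by rewrite mul1r.
Qed.

(** Uniformity of the unmarked part [D] is preserved by every request. Multiplying the average by
    the binomial coefficient avoids conditional probabilities. *)
Lemma sum_rm_cost (R : realType) (T : finType) (k : nat) (U M : {set T})
    (sigma : seq T) :
  (0 < k)%N -> [disjoint M & U] -> (#|M| <= k)%N -> (k <= #|M| + #|U|)%N ->
  \sum_(D : {set T} | (D \subset U) && (#|D| == (k - #|M|)%N))
      rm_cost R k (M :|: D, M) sigma
  = 'C(#|U|, k - #|M|)%:R * mean_cost R k U M sigma.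
Proof.
move=> k0; elim: sigma U M => [|p sigma IH] U M MU Mk kMU.
  by rewrite big1 ?mulr0.
rewrite [mean_cost _ _ _ _ _]/=; case: (boolP (p \in M)) => pM.
  rewrite -IH //; apply: eq_bigr => D _.
  rewrite rm_cost_hit ?inE ?pM //; congr rm_cost; congr (_, _).
  by apply/setUidPr; rewrite sub1set.
case: eqVneq => [cM | neqMk].
  (* Every cached page is marked, so [D] is empty. In the new phase [M] takes the role of [U], and
     the [k] subsets of size [k - 1] cancel the eviction weight [1 / k]. *)
  rewrite -cM subnn bin0 mul1r.
  rewrite (big_pred1 set0) => [|D]; last first.
    by rewrite cards_eq0 andb_idl // => /eqP ->; rewrite sub0set.
  rewrite setU0 rm_cost_new_phase ?cM //.
  have := IH M [set p]; rewrite cards1 cM subn1 => -> //; last by rewrite disjoints1.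
  by rewrite -(prednK k0) binSn /= mulrA mulVf ?mul1r // pnatr_eq0.
have [j Ej] : exists j, (k - #|M| = j.+1)%N by exists (k - #|M|).-1; lia.
have Ek : k = (#|M| + j.+1)%N by lia.
have cpM : #|p |: M| = #|M|.+1 by rewrite cardsU1 pM.
have Ej' : (k - #|p |: M| = j)%N by lia.
have j0 : j.+1%:R != 0 :> R by rewrite pnatr_eq0.
have evict (D : {set T}) : D \subset U -> #|D| = j.+1 -> p \notin D ->
    rm_cost R k (M :|: D, M) (p :: sigma) = 1 + j.+1%:R^-1 *
      \sum_(q in D) rm_cost R k (p |: M :|: D :\ q, p |: M) sigma.
  move=> DU cD pD; have := @rm_cost_evict_unmarked R T p M D sigma pM pD.
  rewrite cD -Ek; apply => //; exact: disjointWr MU.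
rewrite Ej; case: (boolP (p \in U)) => pU; last first.
  under eq_bigr => D /andP[DU /eqP cD].
    rewrite evict //; last by apply: contra pU => /(subsetP DU).
    over.
  rewrite big_split /= sum_subsets1 -mulr_sumr.
  rewrite (sum_subsets_evict _ _ (fun E => rm_cost R k (p |: M :|: E, p |: M) sigma)).
  have := IH U (p |: M); rewrite Ej' cpM => ->; try lia; last first.
  - by rewrite -setI_eq0 setIUl setU_eq0 !setI_eq0 disjoints1 pU.
  - have := mul_bin_left #|U| j => /(congr1 (fun n => n%:R : R)).
    rewrite !natrM => H; rewrite mulrDr mulr1; congr (_ + _).
    apply: (mulfI j0); rewrite !mulrA H mulfV ?mul1r //.
(* Whether [p] is a hit or a fault, what remains of [D] is a [j]-subset of [U :\ p], so both cases
   lead to the same continuation. *)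
rewrite (bigID (fun D : {set T} => p \in D)).
have pMU : [disjoint p |: M & U :\ p].
  rewrite -setI_eq0 setIUl setU_eq0 !setI_eq0 disjoints1 !inE eqxx.
  by apply: disjointWr MU; exact: subsetDl.
have cU : #|U| = #|U :\ p|.+1 by rewrite (cardsD1 p U) pU.
have {IH} IH : \sum_(E : {set T} | (E \subset U :\ p) && (#|E| == j))
    rm_cost R k (p |: M :|: E, p |: M) sigma =
    'C(#|U :\ p|, j)%:R * mean_cost R k (U :\ p) (p |: M) sigma.
  by have := IH (U :\ p) (p |: M); rewrite Ej' cpM => -> //; lia.
under eq_bigr => D /andP[/andP[DU cD] pD].
  rewrite rm_cost_hit ?inE ?pD ?orbT //.
  have -> : M :|: D = p |: M :|: D :\ p.
    by rewrite -setUA setUCA setD1K.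
  over.
rewrite (sum_subsets_remove _ (fun E => rm_cost R k (p |: M :|: E, p |: M) sigma)) //.
rewrite IH.
under [X in _ + X = _]eq_bigr => D /andP[/andP[DU /eqP cD] pD] do rewrite evict //.
rewrite (eq_bigl (fun D : {set T} => (D \subset U :\ p) && (#|D| == j.+1))); last first.
  by move=> D; rewrite subsetD1 -!andbA [(_ == _) && _]andbC.
rewrite big_split /= sum_subsets1 -mulr_sumr.
rewrite (sum_subsets_evict _ _ (fun E => rm_cost R k (p |: M :|: E, p |: M) sigma)).
rewrite IH cU.
set n := #|U :\ p| in cU *.
have jn : (j <= n)%N by lia.
have -> : (n.+1 + #|M| - k = n - j)%N by lia.
(* With all binomials expressed through ['C(n, j)], the share of the sets [D] avoiding [p] is
   [(n - j) / (n + 1)], the fault probability in [mean_cost]. *)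
have /(congr1 (fun n => n%:R : R)) := mul_bin_left n j.
have /(congr1 (fun n => n%:R : R)) := mul_bin_diag n.+1 j.
rewrite /= !natrM natrB //.
have n0 : n.+1%:R != 0 :> R by rewrite pnatr_eq0.
set A := mean_cost _ _ _ _ _.
set x := 'C(n.+1, j.+1)%:R; set y := 'C(n, j)%:R; set z := 'C(n, j.+1)%:R.
move: n0 j0; rewrite -!natr1.
move=> n0 j0 Hx Hy.
have -> : x = (j%:R + 1)^-1 * ((n%:R + 1) * y) by rewrite Hx mulKf.
have -> : z = (j%:R + 1)^-1 * ((n%:R - j%:R) * y) by rewrite -Hy mulKf.
by field; rewrite n0 j0.
Qed.

(** Until the cache is full nothing is evicted and both recursions agree step by step. Once it is
    full, [C :\: M] is its own only subset of the required size, so the averaged identity has a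
    single term. *)
Lemma rm_cost_mean (R : realType) (T : finType) (k : nat) (C M : {set T})
    (sigma : seq T) : (0 < k)%N -> M \subset C -> (#|C| <= k)%N ->
  rm_cost R k (C, M) sigma = mean_cost R k (C :\: M) M sigma.
Proof.
move=> k0; elim: sigma C M => [//|p sigma IH] C M MC.
have MCM : M :|: C :\: M = C.
  by apply/setP=> q; rewrite !inE; case: (boolP (q \in M)) => //= /(subsetP MC).
have cCM : #|C| = (#|M| + #|C :\: M|)%N.
  by rewrite cardsDS // subnKC // subset_leq_card.
rewrite leq_eqVlt => /predU1P[Ck | Ck].
  have := @sum_rm_cost R T k (C :\: M) M (p :: sigma) k0.
  rewrite (_ : k - #|M| = #|C :\: M|)%N; last lia.
  rewrite sum_subsets_full binn mul1r MCM; apply; try lia.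
  by rewrite disjoint_sym -setI_eq0 setIDAC setDIl setDv setI0.
have MC' : p |: M \subset p |: C by rewrite setUS.
case: (boolP (p \in C)) => pC.
  have pMC : p |: M \subset C by rewrite subUset sub1set pC.
  rewrite rm_cost_hit // IH //; last exact: ltnW.
  rewrite /=; case: (boolP (p \in M)) => pM.
    by have /setUidPr -> : [set p] \subset M by rewrite sub1set.
  rewrite ltn_eqF; last lia.
  rewrite inE pM pC /= (_ : _ - k = 0)%N; last lia.
  by rewrite mul0r add0r setDDl setUC.
have pM : p \notin M by apply: contra pC => /(subsetP MC).
rewrite rm_cost_fill // IH //; last by rewrite cardsU1 pC.
rewrite /= (negbTE pM) ltn_eqF; last lia.
rewrite inE (negbTE pC) andbF; congr (_ + mean_cost _ _ _ _ _).
apply/setP=> q; rewrite !inE; case: eqVneq => [->|] //=.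
by rewrite (negbTE pC) andbF.
Qed.

(** * Offline steps and the potential *)

Lemma paging_step_card (T : finType) (k : nat) (p : T) (C C' : {set T}) :
  paging_step k p C C' -> (#|C| <= k)%N -> (#|C'| <= k)%N.
Proof.
rewrite /paging_step; case: (boolP (p \in C)) => pC; first by move=> /eqP ->.
case/orP => [/andP[Ck /eqP ->] _ | /existsP[q /andP[qC /eqP ->]]].
  by rewrite cardsU1 pC.
by rewrite cardsU1 !inE (negbTE pC) andbF (cardsD1 q C) qC.
Qed.

Lemma paging_step_mem (T : finType) (k : nat) (p : T) (C C' : {set T}) :
  paging_step k p C C' -> p \in C'.
Proof.
rewrite /paging_step; case: (boolP (p \in C)) => pC; first by move=> /eqP ->.
case/orP => [/andP[Ck /eqP ->]|/existsP[q /andP[qC /eqP ->]]];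
  by rewrite !inE eqxx.
Qed.

Lemma paging_step_sub (T : finType) (k : nat) (p : T) (C C' : {set T}) :
  paging_step k p C C' -> C' \subset p |: C.
Proof.
rewrite /paging_step; case: (boolP (p \in C)) => pC.
  by move=> /eqP ->; rewrite subsetUr.
case/orP => [/andP[Ck /eqP ->]|/existsP[q /andP[qC /eqP ->]]] //.
by rewrite setUS ?subsetDl.
Qed.

Lemma paging_step_evicted (T : finType) (k : nat) (p : T) (C C' : {set T}) :
  paging_step k p C C' -> (#|C :\: C'| <= (p \notin C))%N.
Proof.
rewrite /paging_step; case: (boolP (p \in C)) => pC /=.
  by move=> /eqP ->; rewrite setDv cards0.
case/orP => [/andP[Ck /eqP ->]|/existsP[q /andP[qC /eqP ->]]].
  rewrite (_ : _ :\: _ = set0) ?cards0 //; apply/eqP.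
  by rewrite setD_eq0 subsetUr.
rewrite -(cards1 q) subset_leq_card //; apply/subsetP=> x; rewrite !inE.
by case: eqVneq => // xq; case: eqVneq => //= _ /andP[/negbTE ->].
Qed.

Definition opt_potential (T : finType) (U M O : {set T}) : nat :=
  (#|M :\: O| + #|O :\: (M :|: U)|)%N.

(* The factor 2: a fault may evict a page of M from O, and it also keeps the
   second term of the potential from dropping when p is outside M and U. *)
Lemma opt_potential_step (T : finType) (k : nat) (p : T)
    (U U' M O O' : {set T}) :
  paging_step k p O O' -> p |: M :|: U' = p |: (M :|: U) ->
  (opt_potential U' (p |: M) O' + (p \notin M :|: U)
    <= opt_potential U M O + 2 * (p \notin O))%N.
Proof.
move=> step E; rewrite /opt_potential E; set X := M :|: U.
have pO' := paging_step_mem step.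
have le1 : (#|(p |: M) :\: O'| <= #|M :\: O| + (p \notin O))%N.
  apply: leq_trans (leq_add (leqnn _) (paging_step_evicted step)).
  apply: leq_trans (leq_card_setU _ _).
  apply/subset_leq_card/subsetP => x; rewrite !inE.
  case: eqVneq => [->|] /=; first by rewrite pO'.
  by move=> _ /andP[-> ->]; case: (x \in O).
have le2 : (#|O' :\: (p |: X)| + (p \notin X) <= #|O :\: X| + (p \notin O))%N.
  have sub : O' :\: (p |: X) \subset O :\: X :\ p.
    apply/subsetP => x; rewrite !inE negb_or -andbA => /and3P[xp -> xO'].
    have := subsetP (paging_step_sub step) _ xO'.
    by rewrite !inE (negbTE xp).
  have := subset_leq_card sub; rewrite (cardsD1 p (O :\: X)) in_setD.
  by case: (p \in X); case: (p \in O) => /=; lia.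
by move: le1 le2; lia.
Qed.

(** * Harmonic numbers and the competitive bound *)

Definition harmonic_sum (R : realType) (n : nat) : R :=
  \sum_(i < n) i.+1%:R^-1.

Lemma harmonic_sumS (R : realType) (n : nat) :
  harmonic_sum R n.+1 = harmonic_sum R n + n.+1%:R^-1.
Proof. exact: big_ord_recr. Qed.

Lemma harmonic_sum_ge0 (R : realType) (n : nat) : 0 <= harmonic_sum R n.
Proof. by apply: sumr_ge0 => i _; rewrite invr_ge0. Qed.

Lemma le_harmonic_sum (R : realType) (m n : nat) :
  (m <= n)%N -> harmonic_sum R m <= harmonic_sum R n.
Proof.
move=> /subnKC <-; elim: (n - m)%N => [|d IH]; first by rewrite addn0.
by rewrite addnS harmonic_sumS (le_trans IH) // lerDl invr_ge0.
Qed.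

(** The factor 2 comes from [1 / (x + 1) <= 2 / (x + 2)], while
    [ln (x + 2) - ln (x + 1) >= 1 / (x + 2)]. *)
Lemma harmonic_sum_le_ln (R : realType) (n : nat) :
  harmonic_sum R n <= 2 * ln (1 + n%:R).
Proof.
elim: n => [|n IH]; first by rewrite /harmonic_sum big_ord0 addr0 ln1 mulr0.
rewrite harmonic_sumS -natr1.
set x : R := n%:R; have x0 : 0 <= x by rewrite ler0n.
have := @le_ln1Dx R (- (x + 2)^-1).
have x2 : (x + 2)^-1 < 1 by rewrite invf_lt1; lra.
have -> : 1 + - (x + 2)^-1 = (1 + x) / (1 + (x + 1)) by field; lra.
rewrite ln_div ?posrE; [|lra|lra].
have : (x + 1)^-1 <= 2 * (x + 2)^-1.
  rewrite -[leLHS]mul1r ler_pdivrMr; last lra.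
  rewrite mulrAC ler_pdivlMr; lra.
move: IH; rewrite -/x; lra.
Qed.

(* On the request of an unmarked page of U, at cost (|U| + |M| - k) / |U|, the
   last term of the bound drops by exactly this cost. *)
Lemma mean_cost_le (R : realType) (T : finType) (k : nat) (U M O : {set T})
    (sigma : seq T) (w : seq {set T}) :
  (#|M| <= k)%N -> (#|U| <= k)%N -> (#|O| <= k)%N -> offline_run k O sigma w ->
  mean_cost R k U M sigma <=
    (1 + harmonic_sum R k) * (2 * faults O sigma w + opt_potential U M O)%:R
    + (#|U| + #|M| - k)%:R * harmonic_sum R #|U|.
Proof.
have H0 := harmonic_sum_ge0 R.
elim: sigma U M O w => [|p sigma IH] U M O [|O' w] //= Mk Uk Ok.
  by move=> _; rewrite addr_ge0 ?mulr_ge0 ?addr_ge0.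
case/andP=> step run; have Ok' := paging_step_card step Ok.
case: (boolP (p \in M)) => pM.
  apply: le_trans (IH _ _ _ _ Mk Uk Ok' run) _.
  have pMM : p |: M = M by apply/setUidPr; rewrite sub1set.
  have := @opt_potential_step T k p U U M O O' step.
  rewrite setUA pMM => /(_ erefl) le_pot.
  by rewrite lerD2r ler_wpM2l ?addr_ge0 // ler_nat; move: le_pot; lia.
have cpM : #|p |: M| = #|M|.+1 by rewrite cardsU1 pM.
case: eqVneq => [cM | neqMk].
  apply: le_trans (lerD (lexx 1) (IH _ _ _ _ _ _ Ok' run)) _.
  - by rewrite cards1 (leq_trans _ Ok') // (cardsD1 p) (paging_step_mem step).
  - exact: Mk.
  (* The phase change comes first: it turns the potential into [#|O :\: M|], which is at most
     [#|M :\: O|] because [#|O| <= k = #|M|]. The request of [p] is then clean. *)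
  have := @opt_potential_step T k p M M set0 O O' step.
  rewrite !setU0 set0U pM => /(_ erefl) le_pot.
  have OM : (#|O :\: M| <= #|M :\: O|)%N.
    have := cardsID M O; have := cardsID O M; rewrite setIC; lia.
  have le_pot' : (2 * faults O' sigma w + opt_potential M [set p] O' + 1
      <= 2 * ((p \notin O) + faults O' sigma w) + opt_potential U M O)%N.
    by move: le_pot; rewrite /opt_potential set0D cards0 set0U; lia.
  (* Exactly one page of the new [U] is missing, so the last term is [H_k]; with the fault it costs
     [1 + H_k], paid by the potential. *)
  rewrite cards1 cM addKn -(ler_nat R) in le_pot' *.
  have := ler_wpM2l (addr_ge0 ler01 (H0 k)) le_pot'; rewrite natrD.
  by have := mulr_ge0 (ler0n R (#|U| + k - k)) (H0 #|U|); lra.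
have Mk' : (#|p |: M| <= k)%N by rewrite cpM; lia.
case: (boolP (p \in U)) => pU.
  have cU : #|U| = #|U :\ p|.+1 by rewrite (cardsD1 p U) pU.
  apply: le_trans (lerD (lexx _) (IH _ _ _ _ Mk' _ Ok' run)) _.
    by lia.
  have := @opt_potential_step T k p U (U :\ p) M O O' step.
  have pMU : p |: (M :|: U) = M :|: U.
    by apply/setUidPr; rewrite sub1set inE pU orbT.
  rewrite -setUA setUCA setD1K // => /(_ (esym pMU)) le_pot.
  have le_pot' : (2 * faults O' sigma w + opt_potential (U :\ p) (p |: M) O'
      <= 2 * ((p \notin O) + faults O' sigma w) + opt_potential U M O)%N.
    by move: le_pot; lia.
  have -> : (#|U :\ p| + #|p |: M| - k = #|U| + #|M| - k)%N by lia.
  rewrite -(ler_nat R) in le_pot'.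
  have := ler_wpM2l (addr_ge0 ler01 (H0 k)) le_pot'.
  have -> : harmonic_sum R #|U| = harmonic_sum R #|U :\ p| + #|U|%:R^-1.
    by rewrite cU harmonic_sumS.
  by lra.
apply: le_trans (lerD (lexx 1) (IH _ _ _ _ Mk' Uk Ok' run)) _.
have := @opt_potential_step T k p U U M O O' step.
rewrite -setUA inE negb_or pM pU => /(_ erefl) le_pot.
have le_pot' : (2 * faults O' sigma w + opt_potential U (p |: M) O' + 1
    <= 2 * ((p \notin O) + faults O' sigma w) + opt_potential U M O)%N.
  by move: le_pot; lia.
rewrite -(ler_nat R) natrD in le_pot'.
have := ler_wpM2l (addr_ge0 ler01 (H0 k)) le_pot'.
have : (#|U| + #|p |: M| - k <= #|U| + #|M| - k + 1)%N by lia.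
rewrite -(ler_nat R) natrD => /(ler_wpM2r (H0 #|U|)).
by have := le_harmonic_sum R Uk; lra.
Qed.

Theorem theorem29 (R : realType) :
  exists K : R, forall (k : nat) (T : finType), (1 <= k)%N ->
    exists b : R, forall (C0 : {set T}), (#|C0| <= k)%N ->
      forall sigma : seq T,
        rm_expected_cost R k C0 sigma
          <= K * ln (1 + k%:R) * (opt_cost k C0 sigma)%:R + b.
Proof.
(* [8 = 2 * 2 * 2]: two clean requests per offline fault, [1 + H_k <= 2 * H_k] as [H_1 = 1], and
   [H_k <= 2 * ln (1 + k)]. The additive constant is 0 since both algorithms start from [C0], where
   the potential vanishes. *)
exists 8 => k T k0; exists 0 => C0 C0k sigma; rewrite addr0.
have [w run <-] := opt_cost_attained C0 sigma k0.
rewrite /rm_expected_cost (rm_expected_costE R (C0, set0)) //.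
rewrite rm_cost_mean ?sub0set // setD0.
apply: le_trans (mean_cost_le R _ C0k C0k run) _; first by rewrite cards0.
rewrite /opt_potential set0D set0U setDv cards0 !addn0.
rewrite (eqP (_ : #|C0| - k == 0)%N) ?subn_eq0 // mul0r addr0.
rewrite natrM mulrA; apply: ler_wpM2r; first exact: ler0n.
have Hk := harmonic_sum_le_ln R k.
have := le_harmonic_sum R k0.
by rewrite /harmonic_sum big_ord1 invr1 -/(harmonic_sum R k); lra.
Qed.
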